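(* Let $G$ be an abelian group with identity $e$ and $g\in G$. For $i=1,2$ let $R_i$ be a $G$-graded $gr$-Noetherian ring, $M_i$ a graded $R_i$-module and $N_i=\oplus_{h\in G}N_{i,h}$ a graded submodule of $M_i$. Let $R=R_1\times R_2$ and $M=M_1\times M_2$ be such that $M_g$ is a fully $g$-idempotent $R_e$-module. Then: (i) $N_{1,g}$ is a $g$-$G2$-absorbing submodule of $M_{1,g}$ if and only if $N_{1,g}\times M_{2,g}$ is a $g$-$G2$-absorbing submodule of $M_g$. (ii) $N_{2,g}$ is a $g$-$G2$-absorbing submodule of $M_{2,g}$ if and only if $M_{1,g}\times N_{2,g}$ is a $g$-$G2$-absorbing submodule of $M_g$. (iii) If $N_{1,g}$ is a $g$-primary submodule of $M_{1,g}$ and $N_{2,g}$ is a $g$-primary submodule of $M_{2,g}$, then $N_{1,g}\times N_{2,g}$ is a $g$-$G2$-absorbing submodule of $M_g$.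
   Context: All rings are commutative with identity and all modules are unitary. $G$ is an abelian multiplicative group with identity $e$. A $G$-graded ring is $R=\oplus_{g\in G}R_g$ with $R_gR_h\subseteq R_{gh}$; $R_e$ is a subring containing $1$. $R$ is $gr$-Noetherian if it satisfies the ascending chain condition on graded ideals. A graded $R$-module is $M=\oplus_{g\in G}M_g$ with $R_gM_h\subseteq M_{gh}$; each $M_g$ is an $R_e$-module. A submodule $N$ of $M$ is graded if $N=\oplus_g N_g$ with $N_g=N\cap M_g$. The degree-$h$ components of $R_i$, $M_i$, $N_i$ are written $R_{i,h}$, $M_{i,h}$, $N_{i,h}$. The product $R=R_1\times R_2$ is graded by $R_h=R_{1,h}\times R_{2,h}$, and $M=M_1\times M_2$ is the graded $R$-module (componentwise action) with $M_h=M_{1,h}\times M_{2,h}$. $M_{i,g}$ is regarded as an $R_{i,e}$-module and $M_g$ as an $R_e$-module. The following are for a graded module $M$ over a graded ring $R$ and an $R_e$-submodule $L$ of $M_g$; $(L:_{R_e}X)=\{r\in R_e: rX\subseteq L\}$. $L$ is $g$-idempotent if $L=(L:_{R_e}M_g)^2M_g$; $M_g$ is fully $g$-idempotent if every $R_e$-submodule of $M_g$ is $g$-idempotent. $L$ is $g$-$G2$-absorbing if $L\neq M_g$ and whenever $r,s\in R_e$, $m\in M_g$ with $rsm\in L$, then $r^{k_1}m\in L$ for some $k_1\in\mathbb{Z}^+$, or $s^{k_2}m\in L$ for some $k_2\in\mathbb{Z}^+$, or $rs\in(L:_{R_e}M_g)$. $L$ is $g$-primary if $L\neq M_g$ and whenever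 $r\in R_e$, $m\in M_g$ with $rm\in L$, then $m\in L$ or $r^n\in(L:_{R_e}M_g)$ for some $n\geq1$. *)

(* Defs.v *)
From HB Require Import structures.
From mathcomp Require Import all_boot all_order all_algebra.
From mathcomp Require Import all_classical.

Set Implicit Arguments.
Unset Strict Implicit.
Unset Printing Implicit Defensive.

Import GRing.Theory.

Local Open Scope classical_set_scope.
Local Open Scope ring_scope.

Section DirectSum.
Variables (G : groupType) (V : zmodType).

(* A is the internal direct sum of the additive subgroups A_ h, h in G:
   every x in A has exactly one finitely supported decomposition. *)
Definition internal_direct_sum (A : set V) (A_ : G -> set V) : Prop :=
  [/\ forall h, GRing.zmod_closed [in A_ h],
      forall h, A_ h `<=` A &
      forall x, A x -> exists! c : G -> V,
        [/\ forall h, A_ h (c h),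
            finite_set [set h | c h != 0] &
            \sum_(h \in [set: G]) c h = x]].

End DirectSum.

Section Graded.
Variables (G : groupType) (R : comPzRingType) (R_ : G -> set R).

Definition ring_grading : Prop :=
  internal_direct_sum setT R_ /\
  forall (h k : G) (r s : R), R_ h r -> R_ k s -> R_ (h * k)%g (r * s).

Section Module.
Variables (M : lmodType R) (M_ : G -> set M).

Definition module_grading : Prop :=
  internal_direct_sum setT M_ /\
  forall (h k : G) (r : R) (x : M), R_ h r -> M_ k x -> M_ (h * k)%g (r *: x).

Definition graded_submodule (N : set M) : Prop :=
  GRing.submod_closed [in N] /\
  internal_direct_sum N (fun h => N `&` M_ h).

(* L is an R_e-submodule of M_g *)
Definition Re_submodule (g : G) (L : set M) : Prop :=
  [/\ L `<=` M_ g,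
      GRing.zmod_closed [in L] &
      forall (r : R) (x : M), R_ 1%g r -> L x -> L (r *: x)].

(* (L :_{R_e} X) *)
Definition colon (L X : set M) : set R :=
  [set r | R_ 1%g r /\ forall x, X x -> L (r *: x)].

(* I X: the finite sums of products r x with r in I and x in X *)
Definition ideal_mul (I : set R) (X : set M) : set M :=
  [set y | exists (n : nat) (r : 'I_n -> R) (x : 'I_n -> M),
     (forall i, I (r i) /\ X (x i)) /\ y = \sum_(i < n) r i *: x i].

End Module.

Definition graded_ideal (I : set R) : Prop :=
  graded_submodule (M := R^o) R_ I.

Definition gr_noetherian : Prop :=
  forall I : nat -> set R,
    (forall n, graded_ideal (I n)) ->
    (forall n, I n `<=` I n.+1) ->
    exists n, forall m, (n <= m)%N -> I m = I n.

Definition ideal_sqr (I : set R) : set R := ideal_mul (M := R^o) I I.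

Section Submodules.
Variables (M : lmodType R) (M_ : G -> set M) (g : G).

Definition g_idempotent (L : set M) : Prop :=
  L = ideal_mul (ideal_sqr (colon L (M_ g))) (M_ g).

Definition fully_g_idempotent : Prop :=
  forall L : set M, Re_submodule M_ g L -> g_idempotent L.

Definition g_G2_absorbing (L : set M) : Prop :=
  [/\ Re_submodule M_ g L,
      L <> M_ g &
      forall (r s : R) (m : M),
        R_ 1%g r -> R_ 1%g s -> M_ g m -> L ((r * s) *: m) ->
        [\/ exists2 k1 : nat, (0 < k1)%N & L (r ^+ k1 *: m),
            exists2 k2 : nat, (0 < k2)%N & L (s ^+ k2 *: m) |
            colon L (M_ g) (r * s)]].

Definition g_primary (L : set M) : Prop :=
  [/\ Re_submodule M_ g L,
      L <> M_ g &
      forall (r : R) (m : M),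
        R_ 1%g r -> M_ g m -> L (r *: m) ->
        L m \/ exists2 n : nat, (0 < n)%N & colon L (M_ g) (r ^+ n)].

End Submodules.

End Graded.

(* M1 x M2 as a module over the product ring R1 x R2. An alias is needed because
   the library's module structure on pairs has a common scalar ring. *)
Definition prod_module (R1 R2 : comPzRingType)
  (M1 : lmodType R1) (M2 : lmodType R2) : Type := (M1 * M2)%type.

Section ProdModule.
Variables (R1 R2 : comPzRingType) (M1 : lmodType R1) (M2 : lmodType R2).
Local Notation R := (R1 * R2)%type.
Local Notation M := (prod_module M1 M2).

HB.instance Definition _ := GRing.Zmodule.copy M (M1 * M2)%type.

Definition prod_scale (r : R) (x : M) : M := (r.1 *: x.1, r.2 *: x.2).

Fact prod_scaleA (a b : R) (x : M) :
  prod_scale a (prod_scale b x) = prod_scale (a * b) x.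
Proof. by rewrite /prod_scale /= !scalerA. Qed.

Fact prod_scale1 : left_id 1 prod_scale.
Proof. by move=> [x y]; rewrite /prod_scale /= !scale1r. Qed.

Fact prod_scaleDr : right_distributive prod_scale +%R.
Proof. by move=> a x y; rewrite /prod_scale /= !scalerDr. Qed.

Fact prod_scaleDl (x : M) : {morph prod_scale^~ x : a b / a + b}.
Proof. by move=> a b; rewrite /prod_scale /= !scalerDl. Qed.

HB.instance Definition _ :=
  GRing.Zmodule_isLmodule.Build R M
    prod_scaleA prod_scale1 prod_scaleDr prod_scaleDl.

End ProdModule.

Definition prod_ring_grading (G : groupType) (R1 R2 : comPzRingType)
  (R1_ : G -> set R1) (R2_ : G -> set R2) : G -> set (R1 * R2) :=
  fun h => R1_ h `*` R2_ h.

Definition prod_module_grading (G : groupType) (R1 R2 : comPzRingType)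
  (M1 : lmodType R1) (M2 : lmodType R2)
  (M1_ : G -> set M1) (M2_ : G -> set M2) : G -> set (prod_module M1 M2) :=
  fun h => M1_ h `*` M2_ h.

(* Main.v *)
(** Parts (i) and (ii) are instances of the fact that being G2-absorbing
    transfers both ways along surjections, applied to the two projections.
    For (iii), the radical of the colon ideal of a primary submodule is prime,
    so the only case not settled by powers of r or of s alone is r s in the
    radical of (L : M_g).  There idempotence is used: for a in R_e the submodule
    K = a M_g satisfies K = (K : M_g)^2 M_g, which lies in (K : M_g) a M_g and
    hence in a K = a^2 M_g; so a M_g = a^n M_g for all n > 0, and the ideal
    (L : M_g) is radical. *)

Require Import Defs.
From mathcomp Require Import all_boot all_order all_algebra.
From mathcomp Require Import all_classical.

Set Implicit Arguments.
Unset Strict Implicit.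
Unset Printing Implicit Defensive.

Local Open Scope classical_set_scope.
Local Open Scope ring_scope.

Import GRing.Theory.

(** * Additive subgroups given as sets *)

Section ClosedSets.
Variables (V : zmodType) (A : set V).

Lemma zmod_closed_setP :
  GRing.zmod_closed [in A] <-> A 0 /\ forall x y, A x -> A y -> A (x - y).
Proof.
split=> -[A0 AB]; split.
- by have := A0; rewrite inE.
- by move=> x y Ax Ay; have := AB x y; rewrite !inE; apply.
- by rewrite inE.
- by move=> x y; rewrite !inE; apply: AB.
Qed.

Lemma zmod_closed_sum (n : nat) (c : 'I_n -> V) :
  GRing.zmod_closed [in A] -> (forall i, A (c i)) -> A (\sum_i c i).
Proof.
move=> /zmod_closed_setP[A0 AB] Ac; apply: big_ind => // x y Ax Ay.
by rewrite -[y]opprK; apply: (AB) => //; rewrite -sub0r; apply: AB.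
Qed.

End ClosedSets.

(** * Homogeneous components, and what idempotence gives for scalar multiples of [M_ g] *)

Section GradedModule.
Variables (G : groupType) (R : comPzRingType) (R_ : G -> set R).

Lemma ring_grading_degree1_0 : ring_grading R_ -> R_ 1%g 0.
Proof. by move=> [[/(_ 1%g) /zmod_closed_setP[]]]. Qed.

Lemma ring_grading_degree1M :
  ring_grading R_ -> forall r s : R, R_ 1%g r -> R_ 1%g s -> R_ 1%g (r * s).
Proof.
by move=> gradR r s Rr Rs; rewrite -[X in R_ X](mulg1 1%g); apply: gradR.2.
Qed.

(** Stated for the degree-[1] part alone, so that the section applies to the product ring without a
    proof that [prod_ring_grading] is a direct sum decomposition. *)
Hypothesis degree1M : forall r s : R, R_ 1%g r -> R_ 1%g s -> R_ 1%g (r * s).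

Lemma degree1X (n : nat) (r : R) : (0 < n)%N -> R_ 1%g r -> R_ 1%g (r ^+ n).
Proof.
case: n => // n _ Rr; elim: n => [|n IH]; first by rewrite expr1.
by rewrite exprS; apply: degree1M.
Qed.

Variables (M : lmodType R) (M_ : G -> set M) (g : G).

Lemma Re_submodule_full : module_grading R_ M_ -> Re_submodule R_ M_ g (M_ g).
Proof.
move=> [[zM _ _] RM]; split=> // r x Rr Mx.
by rewrite -[X in M_ X](mul1g g); apply: RM.
Qed.

Lemma Re_submodule_component (N : set M) :
  module_grading R_ M_ -> graded_submodule M_ N ->
  Re_submodule R_ M_ g (N `&` M_ g).
Proof.
move=> /Re_submodule_full[_ _ RM] [[N0 Nlin] [zN _ _]].
split=> [x []||r x Rr [Nx Mx]] //; split; last exact: RM.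
by have := Nlin r x 0; rewrite addr0 !inE; apply=> //; have := N0; rewrite inE.
Qed.

Lemma Re_submoduleX (L : set M) (n : nat) (r : R) (x : M) :
  Re_submodule R_ M_ g L -> R_ 1%g r -> L x -> L (r ^+ n *: x).
Proof.
move=> [_ _ RL] Rr Lx; case: n => [|n]; first by rewrite expr0 scale1r.
by apply: RL => //; apply: degree1X.
Qed.

Hypothesis subM : Re_submodule R_ M_ g (M_ g).

Lemma Re_submodule_image (a : R) :
  R_ 1%g a -> Re_submodule R_ M_ g [set a *: x | x in M_ g].
Proof.
move=> Ra; have [_ /zmod_closed_setP[M0 MB] RM] := subM.
split=> [_ [x Mx <-]||r _ Rr [x Mx <-]].
- exact: RM.
- apply/zmod_closed_setP; split; first by exists 0; rewrite ?scaler0.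
  move=> _ _ [x Mx <-] [y My <-].
  by exists (x - y); [apply: MB | rewrite scalerBr].
- by exists (r *: x); [apply: RM | rewrite !scalerA mulrC].
Qed.

Hypothesis idemM : fully_g_idempotent R_ M_ g.

Lemma fully_idempotent_image_sqr (a : R) (x : M) :
  R_ 1%g a -> M_ g x -> exists2 y, M_ g y & a *: x = a ^+ 2 *: y.
Proof.
move=> Ra Mx; set K := [set a *: z | z in M_ g].
have Kx : K (a *: x) by exists x.
(* An element of [ideal_mul] is a finite sum, so the fact that $a^2 M_g$ is an additive subgroup
   reduces the claim to single summands, in the outer product and then in the square of the colon
   ideal. *)
have [_ zK2 _] := Re_submodule_image (degree1X (isT : (0 < 2)%N) Ra).
suff [y My <-] : [set a ^+ 2 *: z | z in M_ g] (a *: x) by exists y.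
rewrite [K](idemM (Re_submodule_image Ra)) in Kx.
have [n [r [z [rzP ->]]]] := Kx; apply: zmod_closed_sum (zK2) _ => i.
have [[m [s [t [stP ->]]]] Mz] := rzP i.
rewrite scaler_suml; apply: zmod_closed_sum zK2 _ => j.
have [[_ sK] [_ tK]] := stP j.
(* Each colon factor is traded for one factor [a]: $tz = au$ and $su = av$, hence $stz = a(su) = a^2
   v$. *)
have [u Mu tu] := tK _ Mz; have [v Mv sv] := sK _ Mu.
exists v => //.
by rewrite expr2 -scalerA sv -scalerA -tu !scalerA mulrC.
Qed.

Lemma fully_idempotent_imageX (n : nat) (a : R) (x : M) :
  R_ 1%g a -> M_ g x -> exists2 y, M_ g y & a *: x = a ^+ n.+1 *: y.
Proof.
move=> Ra; elim: n x => [|n IH] x Mx; first by exists x.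
have [y My ->] := fully_idempotent_image_sqr Ra Mx.
have [z Mz yz] := IH y My.
by exists z; rewrite // expr2 -scalerA yz scalerA -exprS.
Qed.

(** Every $ax$ can be rewritten as $a^n y$ with $y$ in [M_ g]. This strips the exponent that primary
    submodules leave on the product $rs$. *)
Lemma fully_idempotent_colon_radical (L : set M) (n : nat) (a : R) :
  R_ 1%g a -> (0 < n)%N -> colon R_ L (M_ g) (a ^+ n) -> colon R_ L (M_ g) a.
Proof.
case: n => // n Ra _ [_ anL]; split=> // x Mx.
by have [y My ->] := fully_idempotent_imageX n Ra Mx; apply: anL.
Qed.

End GradedModule.

(** * Products of two scalars over a primary submodule *)

Section Primary.
Variables (G : groupType) (R : comPzRingType) (R_ : G -> set R).
Hypothesis degree1M : forall r s : R, R_ 1%g r -> R_ 1%g s -> R_ 1%g (r * s).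
Variables (M : lmodType R) (M_ : G -> set M) (g : G).
Hypothesis subM : Re_submodule R_ M_ g (M_ g).

(** The primary condition is applied to $r(sm)$ and, if $sm \in L$, once more to $sm$. The bound
    holds for all large [k], so that the two factors of a product can later share one exponent. *)
Lemma g_primary_mul (L : set M) (r s : R) (m : M) :
  g_primary R_ M_ g L -> R_ 1%g r -> R_ 1%g s -> M_ g m -> L ((r * s) *: m) ->
  exists n : nat, forall k : nat, (n <= k)%N ->
    [\/ L m, forall x, M_ g x -> L (r ^+ k *: x) |
        forall x, M_ g x -> L (s ^+ k *: x)].
Proof.
have [_ _ RM] := subM; move=> [subL _ primL] Rr Rs Mm; rewrite -scalerA.
have colonX a n k x : R_ 1%g a -> colon R_ L (M_ g) (a ^+ n) -> (n <= k)%N ->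
    M_ g x -> L (a ^+ k *: x).
  move=> Ra [_ aL] /subnK <- Mx; rewrite exprD -scalerA.
  by apply: Re_submoduleX subL Ra _ => //; apply: aL.
move=> /(primL r _ Rr (RM _ _ Rs Mm)).
case=> [/(primL s _ Rs Mm)[Lm|[n _ sL]]|[n _ rL]].
- by exists 0%N => k _; apply: Or31.
- by exists n => k nk; apply: Or33 => x; apply: colonX sL nk.
- by exists n => k nk; apply: Or32 => x; apply: colonX rL nk.
Qed.

End Primary.

(** * Transfer of G2-absorption along surjections *)

Section Preimage.
Variables (G : groupType) (R R' : comPzRingType).
Variables (R_ : G -> set R) (R'_ : G -> set R').
Hypothesis degree1M : forall r s : R, R_ 1%g r -> R_ 1%g s -> R_ 1%g (r * s).
Variables (M : lmodType R) (M' : lmodType R').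
Variables (M_ : G -> set M) (M'_ : G -> set M') (g : G).
Variables (phi : {rmorphism R -> R'}) (f : {additive M -> M'}).
Hypothesis fZ : forall r x, f (r *: x) = phi r *: f x.
Hypothesis phi_onto : phi @` R_ 1%g = R'_ 1%g.
Hypothesis f_onto : f @` M_ g = M'_ g.
Hypothesis subM : Re_submodule R_ M_ g (M_ g).
Variable L' : set M'.
Hypothesis subL' : Re_submodule R'_ M'_ g L'.

Let L := M_ g `&` f @^-1` L'.

Let phiR r : R_ 1%g r -> R'_ 1%g (phi r).
Proof. by move=> Rr; rewrite -phi_onto; exists r. Qed.

Let fM x : M_ g x -> M'_ g (f x).
Proof. by move=> Mx; rewrite -f_onto; exists x. Qed.

Lemma Re_submodule_preimage : Re_submodule R_ M_ g L.
Proof.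
have [_ /zmod_closed_setP[M0 MB] RM] := subM.
have [_ /zmod_closed_setP[L0 LB] RL] := subL'.
split=> [x []||r x Rr [Mx Lx]] //.
- apply/zmod_closed_setP; split; first by split=> //=; rewrite raddf0.
  move=> x y [Mx Lx] [My Ly]; split; first exact: MB.
  by rewrite /= raddfB; apply: LB.
- by split; [apply: RM | rewrite /= fZ; apply: RL => //; apply: phiR].
Qed.

Lemma preimage_eq_full : L = M_ g <-> L' = M'_ g.
Proof.
have [L'M _ _] := subL'; split=> [LM|L'E].
  apply/seteqP; split=> // _ /[!(esym f_onto)] -[x Mx <-].
  by rewrite -LM in Mx; case: Mx.
apply/seteqP; split=> [x []|x Mx] //; split=> //=.
by rewrite L'E; apply: fM.
Qed.

Lemma colon_preimage (r : R) :
  R_ 1%g r -> colon R_ L (M_ g) r <-> colon R'_ L' (M'_ g) (phi r).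
Proof.
have [_ _ RM] := subM; move=> Rr; split=> -[_ rL].
  split=> [|x]; first exact: phiR.
  by rewrite -f_onto => -[y /rL[_ /=]]; rewrite fZ => ? <-.
split=> // x Mx; split; first exact: RM.
by rewrite /= fZ; apply: rL; apply: fM.
Qed.

(** Membership in [L] of an element of [M_ g] is decided by its image under [f]. Conversely, scalars
    and elements of the target lift by [phi_onto] and [f_onto], so the same instances of the
    condition are tested on both sides. *)
Lemma g_G2_absorbing_preimage :
  g_G2_absorbing R'_ M'_ g L' <-> g_G2_absorbing R_ M_ g L.
Proof.
have [_ _ RM] := subM; split=> -[_ LM abs].
  split; [exact: Re_submodule_preimage | by move/preimage_eq_full |].
  move=> r s m Rr Rs Mm [_ /=]; rewrite fZ rmorphM.
  case/(abs _ _ _ (phiR Rr) (phiR Rs) (fM Mm)) => [[k k0 Lk]|[k k0 Lk]|rsL].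
  - apply: Or31; exists k => //; split=> /=; last by rewrite fZ rmorphXn.
    by apply: RM => //; apply: degree1X.
  - apply: Or32; exists k => //; split=> /=; last by rewrite fZ rmorphXn.
    by apply: RM => //; apply: degree1X.
  - by apply: Or33; apply/colon_preimage; [apply: degree1M | rewrite rmorphM].
split=> //; first by move/preimage_eq_full.
move=> r' s' m'; rewrite -phi_onto -{1}f_onto.
move=> [r Rr <-] [s Rs <-] [m Mm <-]; rewrite -rmorphM -fZ => Lrs.
have : L ((r * s) *: m) by split=> //; apply: RM => //; apply: degree1M.
case/(abs _ _ _ Rr Rs Mm) => [[k k0 [_ /=]]|[k k0 [_ /=]]|rsL].
- by rewrite fZ rmorphXn => Lk; apply: Or31; exists k.
- by rewrite fZ rmorphXn => Lk; apply: Or32; exists k.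
- by apply: Or33; apply/colon_preimage => //; apply: degree1M.
Qed.

End Preimage.

(** * Products of submodules over the product ring *)

Section Product.
Variables (G : groupType) (g : G) (R1 R2 : comPzRingType).
Variables (R1_ : G -> set R1) (R2_ : G -> set R2).
Variables (M1 : lmodType R1) (M2 : lmodType R2).
Variables (M1_ : G -> set M1) (M2_ : G -> set M2).
Local Notation R_ := (prod_ring_grading R1_ R2_).
Local Notation M_ := (prod_module_grading M1_ M2_).
Local Notation M := (prod_module M1 M2).

Lemma prod_expE (r : R1 * R2) n : r ^+ n = (r.1 ^+ n, r.2 ^+ n).
Proof. by rewrite [LHS]surjective_pairing !rmorphXn. Qed.

Lemma Re_submodule_prod (L1 : set M1) (L2 : set M2) :
  Re_submodule R1_ M1_ g L1 -> Re_submodule R2_ M2_ g L2 ->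
  Re_submodule R_ M_ g (L1 `*` L2).
Proof.
move=> [LM1 /zmod_closed_setP[L10 L1B] RL1] [LM2 /zmod_closed_setP[L20 L2B] RL2].
split=> [x [Lx1 Lx2]||r x [Rr1 Rr2] [Lx1 Lx2]].
- by split; [apply: LM1 | apply: LM2].
- apply/zmod_closed_setP; split=> [|x y [Lx1 Lx2] [Ly1 Ly2]]; first by split.
  by split; [apply: L1B | apply: L2B].
- by split; [apply: RL1 | apply: RL2].
Qed.

(** The point [y] rules out an empty second factor, for which the image would be empty. In the uses
    below it is 0. *)
Lemma prod_fst_image (T1 T2 : Type) (A : set T1) (B : set T2) y :
  B y -> fst @` (A `*` B) = A.
Proof.
move=> By; apply/seteqP; split=> [_ [x [Ax _] <-]|x Ax] //.
by exists (x, y).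
Qed.

Lemma prod_snd_image (T1 T2 : Type) (A : set T1) (B : set T2) x :
  A x -> snd @` (A `*` B) = B.
Proof.
move=> Ax; apply/seteqP; split=> [_ [y [_ By] <-]|y By] //.
by exists (x, y).
Qed.

Hypotheses (gradR1 : ring_grading R1_) (gradR2 : ring_grading R2_).
Hypothesis subM1 : Re_submodule R1_ M1_ g (M1_ g).
Hypothesis subM2 : Re_submodule R2_ M2_ g (M2_ g).

Lemma prod_degree1M (r s : R1 * R2) : R_ 1%g r -> R_ 1%g s -> R_ 1%g (r * s).
Proof.
by move=> [Rr1 Rr2] [Rs1 Rs2]; split; apply: ring_grading_degree1M.
Qed.

Lemma g_G2_absorbing_prodl (L : set M1) :
  Re_submodule R1_ M1_ g L ->
  g_G2_absorbing R1_ M1_ g L <-> g_G2_absorbing R_ M_ g (L `*` M2_ g).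
Proof.
move=> subL; have [LM _ _] := subL; have [_ /zmod_closed_setP[M20 _] _] := subM2.
(* Since [L] lies in [M1_ g], the product is the preimage of [L] under the first projection, cut
   down to degree [g]. *)
have -> : L `*` M2_ g = M_ g `&` (fst : M -> M1) @^-1` L.
  by apply/seteqP; split=> [x [Lx Mx]|x [[_ Mx] Lx]]; do ?split=> //; apply: LM.
apply: (@g_G2_absorbing_preimage _ _ _ R_ R1_ prod_degree1M M M1 M_ M1_ g
  (fst : {rmorphism R1 * R2 -> R1}) (fst : {additive M -> M1})) => //.
- exact: prod_fst_image (ring_grading_degree1_0 gradR2).
- exact: prod_fst_image M20.
- exact: Re_submodule_prod.
Qed.

Lemma g_G2_absorbing_prodr (L : set M2) :
  Re_submodule R2_ M2_ g L ->
  g_G2_absorbing R2_ M2_ g L <-> g_G2_absorbing R_ M_ g (M1_ g `*` L).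
Proof.
move=> subL; have [LM _ _] := subL; have [_ /zmod_closed_setP[M10 _] _] := subM1.
have -> : M1_ g `*` L = M_ g `&` (snd : M -> M2) @^-1` L.
  by apply/seteqP; split=> [x [Mx Lx]|x [[Mx _] Lx]]; do ?split=> //; apply: LM.
apply: (@g_G2_absorbing_preimage _ _ _ R_ R2_ prod_degree1M M M2 M_ M2_ g
  (snd : {rmorphism R1 * R2 -> R2}) (snd : {additive M -> M2})) => //.
- exact: prod_snd_image (ring_grading_degree1_0 gradR1).
- exact: prod_snd_image M10.
- exact: Re_submodule_prod.
Qed.

Hypothesis idemM : fully_g_idempotent R_ M_ g.

Lemma g_primary_setX_G2_absorbing (L1 : set M1) (L2 : set M2) :
  g_primary R1_ M1_ g L1 -> g_primary R2_ M2_ g L2 ->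
  g_G2_absorbing R_ M_ g (L1 `*` L2).
Proof.
move=> prim1 prim2; have [subL1 L1M _] := prim1; have [subL2 _ _] := prim2.
split; first exact: Re_submodule_prod.
  have [_ /zmod_closed_setP[L20 _] _] := subL2.
  have [_ /zmod_closed_setP[M20 _] _] := subM2.
  (* Properness is inherited from the first factor: projecting a supposed equality of products would
     give [L1 = M1_ g]. *)
  move=> LM; apply: L1M; rewrite -(prod_fst_image L1 L20) LM.
  exact: prod_fst_image M20.
move=> r s m Rr Rs [Mm1 Mm2] [Lm1 Lm2]; have [Rr1 Rr2] := Rr; have [Rs1 Rs2] := Rs.
have [n1 H1] :=
  g_primary_mul (ring_grading_degree1M gradR1) subM1 prim1 Rr1 Rs1 Mm1 Lm1.
have [n2 H2] :=
  g_primary_mul (ring_grading_degree1M gradR2) subM2 prim2 Rr2 Rs2 Mm2 Lm2.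
(* One exponent above both thresholds; the successor makes it positive, as the absorbing condition
   demands. *)
pose k := (n1 + n2).+1.
have {}H1 := H1 k (leqW (leq_addr _ _)); have {}H2 := H2 k (leqW (leq_addl _ _)).
have X1 a x : R1_ 1%g a -> L1 x -> L1 (a ^+ k *: x).
  by apply: Re_submoduleX subL1; apply: ring_grading_degree1M.
have X2 a x : R2_ 1%g a -> L2 x -> L2 (a ^+ k *: x).
  by apply: Re_submoduleX subL2; apply: ring_grading_degree1M.
have Lr : L1 (r.1 ^+ k *: m.1) -> L2 (r.2 ^+ k *: m.2) ->
    exists2 k1, (0 < k1)%N & (L1 `*` L2) (r ^+ k1 *: (m : M)).
  by move=> ? ?; exists k => //; rewrite prod_expE.
have Ls : L1 (s.1 ^+ k *: m.1) -> L2 (s.2 ^+ k *: m.2) ->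
    exists2 k2, (0 < k2)%N & (L1 `*` L2) (s ^+ k2 *: (m : M)).
  by move=> ? ?; exists k => //; rewrite prod_expE.
(* Here idempotence enters: the assumptions only place $(rs)^k$ in the colon ideal, and radicality
   lowers this to $rs$. *)
have Lrs : (forall x, M1_ g x -> L1 ((r.1 * s.1) ^+ k *: x)) ->
    (forall x, M2_ g x -> L2 ((r.2 * s.2) ^+ k *: x)) ->
    colon (M := M) R_ (L1 `*` L2) (M_ g) (r * s).
  have Rrs : R_ 1%g (r * s) by apply: prod_degree1M.
  move=> rsL1 rsL2.
  apply: (@fully_idempotent_colon_radical _ _ _ prod_degree1M _ _ _ _ _ _ k) => //.
    exact: Re_submodule_prod.
  split; first by apply: degree1X => //; apply: prod_degree1M.
  by move=> x [Mx1 Mx2]; rewrite prod_expE; split; [apply: rsL1 | apply: rsL2].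
(* When the two factors do not call for different scalars, a power of that scalar sends [m] into the
   product; if [m] already lies in it, either scalar would do and [r] is taken. In the two mixed
   cases, [r] in one factor and [s] in the other, $(rs)^k$ works in both factors. *)
case: H1 => [m1L|r1L|s1L]; case: H2 => [m2L|r2L|s2L].
- by apply: Or31; apply: Lr; [apply: X1 | apply: X2].
- by apply: Or31; apply: Lr; [apply: X1 | apply: r2L].
- by apply: Or32; apply: Ls; [apply: X1 | apply: s2L].
- by apply: Or31; apply: Lr; [apply: r1L | apply: X2].
- by apply: Or31; apply: Lr; [apply: r1L | apply: r2L].
- apply: Or33; apply: Lrs => x Mx; rewrite exprMn.
    by rewrite mulrC -scalerA; apply: X1 => //; apply: r1L.
  by rewrite -scalerA; apply: X2 => //; apply: s2L.
- by apply: Or32; apply: Ls; [apply: s1L | apply: X2].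
- apply: Or33; apply: Lrs => x Mx; rewrite exprMn.
    by rewrite -scalerA; apply: X1 => //; apply: s1L.
  by rewrite mulrC -scalerA; apply: X2 => //; apply: r2L.
- by apply: Or32; apply: Ls; [apply: s1L | apply: s2L].
Qed.

End Product.

Theorem theorem3p8 (G : groupType) (abelG : forall x y : G, (x * y)%g = (y * x)%g)
  (g : G)
  (R1 R2 : comPzRingType) (R1_ : G -> set R1) (R2_ : G -> set R2)
  (gradR1 : ring_grading R1_) (gradR2 : ring_grading R2_)
  (noethR1 : gr_noetherian R1_) (noethR2 : gr_noetherian R2_)
  (M1 : lmodType R1) (M2 : lmodType R2)
  (M1_ : G -> set M1) (M2_ : G -> set M2)
  (gradM1 : module_grading R1_ M1_) (gradM2 : module_grading R2_ M2_)
  (N1 : set M1) (N2 : set M2)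
  (gradN1 : graded_submodule M1_ N1) (gradN2 : graded_submodule M2_ N2)
  (R_ := prod_ring_grading R1_ R2_) (M_ := prod_module_grading M1_ M2_)
  (idemM : fully_g_idempotent R_ M_ g)
  (N1g := N1 `&` M1_ g) (N2g := N2 `&` M2_ g) :
  [/\ g_G2_absorbing R1_ M1_ g N1g <-> g_G2_absorbing R_ M_ g (N1g `*` M2_ g),
      g_G2_absorbing R2_ M2_ g N2g <-> g_G2_absorbing R_ M_ g (M1_ g `*` N2g) &
      g_primary R1_ M1_ g N1g -> g_primary R2_ M2_ g N2g ->
        g_G2_absorbing R_ M_ g (N1g `*` N2g)].
Proof.
have subM1 := Re_submodule_full g gradM1; have subM2 := Re_submodule_full g gradM2.
split; last exact: g_primary_setX_G2_absorbing.
- by apply: g_G2_absorbing_prodl => //; apply: Re_submodule_component.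
- by apply: g_G2_absorbing_prodr => //; apply: Re_submodule_component.
Qed.
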